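(* Let $G$ be a split graph with $V(G)=C\cup I$, where $C$ is a maximal clique with $|C|\geq 2$ and $I$ is an independent set (with $C\cap I=\emptyset$). Then: (1) $\chi_{pcf}(G)=\omega(G)$ if and only if $G$ is special. (2) $\chi_{pcf}(G)=\omega(G)+1$ if and only if $G$ is not special.
   Context: All graphs are finite, simple, connected and undirected. $N(v)$ is the open neighborhood of $v$, $[k]=\{1,\dots,k\}$, and $\omega(G)$ is the maximum size of a clique of $G$. A proper conflict-free (PCF) $k$-coloring of a graph $G$ is a proper coloring $f:V(G)\to[k]$ such that for every non-isolated vertex $v$ there is a color (depending on $v$) that appears on exactly one vertex of $N(v)$. $\chi_{pcf}(G)$ is the least $k$ such that $G$ admits a PCF $k$-coloring. A split graph $G$ with the given partition $V(G)=C\cup I$ is special if there exist two distinct vertices $v_i,v_j\in C$ such that: (i) if $x\in I$ is not adjacent to $v_i$, then $x$ has a non-neighbor in $C\setminus\{v_i\}$; and (ii) if $y\in N(v_i)\cap I$ is not adjacent to $v_j$, then $y$ has a non-neighbor in $C\setminus\{v_j\}$. *)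

(* Defs.v *)
From mathcomp Require Import all_boot.
Set Implicit Arguments.
Unset Strict Implicit.
Unset Printing Implicit Defensive.

Record sgraph := SGraph {
  vertex :> finType;
  adj : rel vertex;
  adj_sym : symmetric adj;
  adj_irrefl : irreflexive adj }.

Section Graphs.
Variable G : sgraph.
Implicit Types (x y v u w : G) (A C I K : {set G}).

Definition connected_graph : Prop := forall x y, connect (@adj G) x y.

Definition nbhd v : {set G} := [set u | adj v u].

Definition clique K : bool :=
  [forall x in K, forall y in K, (x != y) ==> adj x y].

Definition independent A : bool :=
  [forall x in A, forall y in A, ~~ adj x y].

Definition omega : nat := \max_(K : {set G} | clique K) #|K|.

Definition split_partition C I : Prop :=
  [/\ C :|: I = [set: G], C :&: I = set0, clique C & independent I].

(* The palette [k] is represented by 'I_k. *)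
Definition proper k (f : {ffun G -> 'I_k}) : bool :=
  [forall x, forall y, adj x y ==> (f x != f y)].

Definition conflict_free k (f : {ffun G -> 'I_k}) : bool :=
  [forall v, (nbhd v != set0) ==>
     [exists c, #|[set u in nbhd v | f u == c]| == 1]].

Definition pcf_colorable k : bool :=
  [exists f : {ffun G -> 'I_k}, proper f && conflict_free f].

(* An injective coloring is PCF, so the minimum below is well defined. *)
Lemma pcf_colorable_ex : exists k, pcf_colorable k.
Proof.
exists #|G|; apply/existsP; exists [ffun x => enum_rank x]; apply/andP; split.
  apply/forallP=> x; apply/forallP=> y; apply/implyP=> xy; rewrite !ffunE.
  by apply: contraTneq xy => /enum_rank_inj->; rewrite adj_irrefl.
apply/forallP=> v; apply/implyP=> /set0Pn[u vu].
apply/existsP; exists (enum_rank u); apply/cards1P; exists u.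
apply/setP=> w; rewrite inE in_set1 ffunE (inj_eq enum_rank_inj).
by case: eqVneq => [->|]; rewrite ?vu ?andbF.
Qed.

Definition chi_pcf : nat := ex_minn pcf_colorable_ex.

Definition special C I : Prop :=
  exists vi vj,
    [/\ vi \in C, vj \in C, vi != vj,
        forall x, x \in I -> ~~ adj x vi ->
          exists2 w, w \in C :\ vi & ~~ adj x w
      & forall y, y \in nbhd vi :&: I -> ~~ adj y vj ->
          exists2 w, w \in C :\ vj & ~~ adj y w].

End Graphs.

Arguments chi_pcf : clear implicits.
Arguments omega : clear implicits.
Arguments connected_graph : clear implicits.

(* Main.v *)
(** Since [C] is maximal, every [x] in [I] misses a vertex of [C], hence
    [omega G = #|C|].  Colouring [C] injectively and [I] with one extra colour
    is PCF, so only [#|C|] colours are in question.  There [C] uses every colour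
    once, so the conflict-free condition at [v] in [C] asks for a vertex [w != v]
    of [C] whose colour is avoided by the neighbours of [v] in [I].  A vertex
    of [I] whose only non-neighbour in [C] is [w] is forced to take the colour
    of [w]; thus being special amounts to having two distinct vertices of [C]
    that are not the unique non-neighbour of a vertex of [I], and every [w]
    produced by the conflict-free condition is such a vertex. *)

Require Import Defs.
From mathcomp Require Import all_boot.
Set Implicit Arguments.
Unset Strict Implicit.
Unset Printing Implicit Defensive.

(** This lets the vertices themselves serve as colours: [A] is the palette, and [enum_rank_in]
    renumbers it into an ordinal type without identifying two colours. The unique colour around [v]
    is given through the neighbour [u] that bears it. *)
Lemma pcf_colorable_card (G : sgraph) (T : finType) (A : {set T}) (f : G -> T) :
    (forall x, f x \in A) ->
    (forall x y, adj x y -> f x != f y) ->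
    (forall v, nbhd v != set0 ->
       exists2 u, adj v u & forall w, adj v w -> f w = f u -> w = u) ->
  pcf_colorable G #|A|.
Proof.
move=> fA fP fcf.
pose g := [ffun x => enum_rank_in (fA x) (f x)].
have gE x y : (g x == g y) = (f x == f y).
  rewrite !ffunE; apply/eqP/eqP => [|fxy].
    by move/(congr1 enum_val); rewrite !enum_rankK_in.
  by apply: enum_val_inj; rewrite !enum_rankK_in.
apply/existsP; exists g; apply/andP; split.
  by apply/forallP=> x; apply/forallP=> y; apply/implyP=> /fP; rewrite gE.
apply/forallP=> v; apply/implyP=> /fcf[u vu uniq_u].
apply/existsP; exists (g u); apply/cards1P; exists u.
apply/setP=> w; rewrite !inE gE; apply/andP/eqP => [[vw /eqP]|->].
  exact: uniq_u.
by rewrite vu.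
Qed.

Lemma pcf_coloringP (G : sgraph) k : pcf_colorable G k ->
  exists f : G -> 'I_k,
    (forall x y, adj x y -> f x != f y) /\
    (forall v, nbhd v != set0 ->
       exists2 u, adj v u & forall w, adj v w -> f w = f u -> w = u).
Proof.
case/existsP=> f /andP[/forallP fP /forallP fcf]; exists f; split=> [x y|v v0].
  by move: (fP x) => /forallP/(_ y)/implyP.
have /existsP[c /cards1P[u uE]] := implyP (fcf v) v0.
have /[!inE]/andP[vu /eqP fu] : u \in [set u in nbhd v | f u == c].
  by rewrite uE set11.
exists u => // w vw; rewrite fu => fw; apply/set1P.
by rewrite -uE !inE vw fw eqxx.
Qed.

Lemma clique_adj (G : sgraph) (K : {set G}) x y :
  clique K -> x \in K -> y \in K -> x != y -> adj x y.
Proof.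
by move=> /forall_inP/(_ x) + xK yK; move=> /(_ xK)/forall_inP/(_ y yK)/implyP.
Qed.

Lemma proper_clique_inj (G : sgraph) (T : eqType) (f : G -> T) (K : {set G}) :
  clique K -> (forall x y, adj x y -> f x != f y) -> {in K &, injective f}.
Proof.
move=> Kcl fP x y xK yK fxy; apply/eqP/negPn/negP=> xy.
by move: (fP _ _ (clique_adj Kcl xK yK xy)); rewrite fxy eqxx.
Qed.

Lemma clique_leq_colors (G : sgraph) (K : {set G}) k :
  clique K -> pcf_colorable G k -> #|K| <= k.
Proof.
move=> Kcl /pcf_coloringP[f [fP _]].
rewrite -(card_in_imset (proper_clique_inj Kcl fP)).
by rewrite (leq_trans (max_card _)) ?card_ord.
Qed.

Section SplitGraph.
Variables (G : sgraph) (C I : {set G}).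
Hypothesis CIsplit : split_partition C I.
Hypothesis Cmax : maxset (@clique G) C.

Let Ccl : clique C. Proof. by case: CIsplit. Qed.

Lemma split_memI x : (x \in I) = (x \notin C).
Proof.
case: CIsplit => /setP/(_ x) + /setP/(_ x) + _ _; rewrite !inE.
by case: (x \in C) => //=; case: (x \in I).
Qed.

Lemma split_independent x y : x \in I -> y \in I -> ~~ adj x y.
Proof. by case: CIsplit => _ _ _ /forall_inP + xI; move/(_ x xI)/forall_inP; apply. Qed.

Lemma split_nonneighbor x : x \in I -> exists2 w, w \in C & ~~ adj x w.
Proof.
rewrite split_memI => xC; apply/exists_inP; apply: contraNT xC.
move=> /exists_inPn xadj; have {}xadj w : w \in C -> adj x w.
  by move/xadj; rewrite negbK.
have /maxsetP[_ maxC] := Cmax; rewrite -(maxC (x |: C)) ?setU11 ?subsetU1 //.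
apply/forall_inP=> y /setU1P[->|yC]; apply/forall_inP=> z /setU1P[->|zC];
  apply/implyP; rewrite ?eqxx // => yz.
- exact: xadj.
- by rewrite adj_sym xadj.
- exact: (clique_adj Ccl).
Qed.

Lemma split_omega : omega G = #|C|.
Proof.
apply/eqP; rewrite eqn_leq; apply/andP; split; last first.
  exact: (@leq_bigmax_cond _ (@clique G) (fun K : {set G} => #|K|)).
apply/bigmax_leqP => K Kcl; case: (boolP (K \subset C)) => [/subset_leq_card //|].
case/subsetPn=> x xK; rewrite -split_memI => xI.
have [w wC xw] := split_nonneighbor xI.
(* An exchange argument: apart from [x], every vertex of [K] is a neighbour of [x], hence lies in
   [C] and differs from [w]. So [K] gains [x] over [C] but loses [w]. *)
rewrite (cardsD1 x) xK (cardsD1 w C) wC leq_add2l; apply: subset_leq_card.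
apply/subsetP=> y /setD1P[yx yK].
have xy : adj x y by rewrite (clique_adj Kcl) // eq_sym.
rewrite !inE; apply/andP; split; first by apply: contraNneq xw => <-.
by apply: contraTT xy; rewrite -split_memI; apply: split_independent.
Qed.

(** All neighbours of [v] lie in [C], where colours do not repeat, so any neighbour is a witness. *)
Lemma clique_coloring_I_cf (T : eqType) (f : G -> T) v :
  {in C &, injective f} -> v \in I -> nbhd v != set0 ->
  exists2 u, adj v u & forall w, adj v w -> f w = f u -> w = u.
Proof.
move=> fI vI /set0Pn[u /[!inE] vu].
have vC w : adj v w -> w \in C.
  by apply: contraTT; rewrite -split_memI; apply: split_independent.
by exists u => // w vw; apply: fI; apply: vC.
Qed.

Lemma split_pcf_colorableS : 2 <= #|C| -> pcf_colorable G #|C|.+1.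
Proof.
move=> Cge2; pose f x := if x \in C then Some x else None.
have fI : {in C &, injective f} by move=> x y xC yC; rewrite /f xC yC => -[].
have -> : #|C|.+1 = #|None |: [set Some x | x in C]|.
  rewrite cardsU1 (card_imset _ (@Some_inj _)) (_ : _ \notin _) //.
  by apply/imsetP=> -[].
apply: (@pcf_colorable_card _ _ _ f).
- by move=> x; rewrite /f; case: ifP => xC; rewrite ?setU11 // setU1r ?imset_f.
- move=> x y; rewrite /f; case: ifP => xC; case: ifP => yC //.
    by apply: contraTneq => -[->]; rewrite adj_irrefl.
  by move/negP; case; apply/negP/split_independent; rewrite split_memI ?xC ?yC.
move=> v v0; case: (boolP (v \in C)) => [vC|]; last first.
  by rewrite -split_memI => vI; apply: clique_coloring_I_cf.
(* As [I] is coloured [None], the colour of a vertex of [C] occurs once in the whole graph; any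
   vertex of [C] other than [v] will do. *)
have [u /setD1P[uv uC]] : exists u, u \in C :\ v.
  by apply/set0Pn; rewrite -card_gt0; move: Cge2; rewrite (cardsD1 v) vC.
exists u; first by rewrite (clique_adj Ccl) // eq_sym.
by move=> w _; rewrite /f uC; case: ifP => // _ [].
Qed.

Lemma special_pcf_colorable : special C I -> pcf_colorable G #|C|.
Proof.
case=> vi [vj [viC vjC vij spi spj]].
(* The colours allowed at [x] in [I]: a non-neighbour in [C] keeps the colouring proper, [vi] is
   reserved throughout [I], and [vj] is reserved among the neighbours of [vi]. *)
pose ok x w := [&& w \in C, ~~ adj x w, w != vi & adj x vi ==> (w != vj)].
(* The default [vi] is never reached: [fok] shows that every [x] in [I] has an allowed colour. *)
pose f x := if x \in C then x else odflt vi [pick w | ok x w].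
have fC x : x \in C -> f x = x by rewrite /f => ->.
have fok x : x \in I -> ok x (f x).
  move=> xI; rewrite /f ifN -?split_memI //; case: pickP => //= nok.
  suff [w] : exists w, ok x w by rewrite nok.
  (* If [x] misses [vi], condition (i) gives the colour. If [x] sees both [vi] and [vj], any
     non-neighbour in [C] avoids both. If [x] sees [vi] only, condition (ii) applies. *)
  rewrite /ok; case: (boolP (adj x vi)) => [xvi|xvi]; last first.
    have [w /setD1P[wvi wC] xw] := spi x xI xvi.
    by exists w; rewrite wC xw wvi.
  have neq w : ~~ adj x w -> w != vi by apply: contraNneq => ->.
  case: (boolP (adj x vj)) => [xvj|xvj].
    have [w wC xw] := split_nonneighbor xI.
    exists w; rewrite wC xw neq //=; apply: contraNneq xw => -> //.
  have xN : x \in nbhd vi :&: I by rewrite !inE adj_sym xvi.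
  have [w /setD1P[wvj wC] xw] := spj x xN xvj.
  by exists w; rewrite wC xw neq.
have notI x : (x \in I) = false -> x \in C by rewrite split_memI => /negbFE.
apply: (@pcf_colorable_card _ _ _ f).
- move=> x; case: (boolP (x \in I)) => [/fok/and4P[] //|/negbTE/notI xC].
  by rewrite fC.
- move=> x y xy; case: (boolP (x \in C)) => [xC|].
    rewrite (fC x) //; case: (boolP (y \in C)) => [yC|].
      by rewrite fC //; apply: contraTneq xy => ->; rewrite adj_irrefl.
    rewrite -split_memI => /fok/and4P[_ yf _ _].
    by apply: contraNneq yf => <-; rewrite adj_sym.
  rewrite -split_memI => xI; have yC : y \in C.
    by apply: contraTT xy; rewrite -split_memI; apply: split_independent.
  by rewrite (fC y) //; case/and4P: (fok x xI) => _ + _ _; apply: contraNneq => ->.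
move=> v v0; case: (boolP (v \in C)) => [vC|]; last first.
  rewrite -split_memI => vI; apply: clique_coloring_I_cf => // x y xC yC.
  by rewrite !fC.
(* [vi] sees the colour [vj] once, every other vertex of [C] sees [vi] once. *)
pose u := if v == vi then vj else vi.
have uC : u \in C by rewrite /u; case: ifP.
have vu : v != u by rewrite /u; case: (eqVneq v vi) => // ->.
exists u; first exact: (clique_adj Ccl).
move=> w vw; rewrite (fC u) //; case: (boolP (w \in C)) => [wC|].
  by rewrite fC.
rewrite -split_memI => /fok/and4P[_ _ wvi wvj] fwu; move: wvi wvj.
rewrite fwu /u; case: (eqVneq v vi) => [<- _|]; last by rewrite eqxx.
by rewrite adj_sym vw eqxx.
Qed.

Lemma pcf_colorable_special : 2 <= #|C| -> pcf_colorable G #|C| -> special C I.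
Proof.
move=> Cge2 /pcf_coloringP[f [fP fcf]].
have fI := proper_clique_inj Ccl fP.
have fsurj c : exists2 w, w \in C & f w = c.
  have /eqP/setP/(_ c) : f @: C == setT.
    by rewrite eqEcard subsetT cardsT card_ord card_in_imset /=.
  by rewrite inE => /imsetP[w wC ->]; exists w.
have unforced v : v \in C -> exists w,
    [/\ w \in C, v != w & forall x, x \in I -> ~~ adj x w ->
          exists2 z, z \in C :\ w & ~~ adj x z].
  move=> vC; have v0 : nbhd v != set0.
    have [u /setD1P[uv uC]] : exists u, u \in C :\ v.
      by apply/set0Pn; rewrite -card_gt0; move: Cge2; rewrite (cardsD1 v) vC.
    by apply/set0Pn; exists u; rewrite inE (clique_adj Ccl) // eq_sym.
  (* The uniquely coloured neighbour [u] of [v] must lie in [C]: the vertex [w] of [C] with its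
     colour is also a neighbour of [v]. *)
  have [u vu uniq_u] := fcf v v0; have [w wC fw] := fsurj (f u).
  have vw : v != w by apply: contraTneq (fP _ _ vu) => ->; rewrite fw eqxx.
  have wu : w = u by apply: uniq_u => //; apply: (clique_adj Ccl).
  subst u; exists w; split=> // x xI xw; apply/exists_inP.
  apply: contraLR xI => /exists_inPn xadj; rewrite split_memI negbK.
  have {}xadj z : z \in C -> z != w -> adj x z.
    by move=> zC zw; rewrite -[adj x z]negbK xadj // in_setD1 zw.
  (* If [x] sees all of [C] but [w], its colour can only be that of [w]. Since [x] also sees [v],
     uniqueness at [v] gives [x = w], which lies in [C]. *)
  have [z zC fz] := fsurj (f x); have zw : z = w.
    apply/eqP/negPn/negP=> zw; move: (fP _ _ (xadj z zC zw)).
    by rewrite fz eqxx.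
  by rewrite (uniq_u x) // -?fz ?zw // adj_sym xadj.
have [v vC] : exists v, v \in C by apply/set0Pn; rewrite -card_gt0 ltnW.
(* The starting vertex [v] is arbitrary; applying [unforced] again at [vi] itself makes [vj]
   distinct from [vi]. *)
have [vi [viC _ spi]] := unforced v vC.
have [vj [vjC vij spj]] := unforced vi viC.
by exists vi, vj; split=> // y /setIP[_]; apply: spj.
Qed.

End SplitGraph.

Theorem theorem10 (G : sgraph) (C I : {set G})
    (Gconn : connected_graph G)
    (CIsplit : split_partition C I)
    (Cmax : maxset (@clique G) C)
    (Cge2 : 2 <= #|C|) :
  (chi_pcf G = omega G <-> special C I) /\
  (chi_pcf G = (omega G).+1 <-> ~ special C I).
Proof.
have Ccl : clique C by case: CIsplit.
rewrite (split_omega CIsplit Cmax) /chi_pcf; case: ex_minnP => k kcol kmin.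
have k_ge := clique_leq_colors Ccl kcol.
have k_le := kmin _ (split_pcf_colorableS CIsplit Cge2).
(* Only the values [#|C|] and [#|C|.+1] remain for [k], so both claims follow from this
   equivalence. *)
have spE : k = #|C| <-> special C I.
  split=> [kC|/(special_pcf_colorable CIsplit Cmax)/kmin kC].
    by apply: (pcf_colorable_special CIsplit Cge2); rewrite -kC.
  by apply/eqP; rewrite eqn_leq kC.
split=> //; split=> [kS /spE kC|nsp].
  by move/eqP: kS; rewrite kC -[X in X == _]addn0 -addn1 eqn_add2l.
apply/eqP; rewrite eqn_leq k_le ltn_neqAle k_ge andbT.
by apply/negP=> /eqP/esym/spE.
Qed.
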